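(* Let $g\geq1$, $n=2g+2$, and let $m$ be a positive squarefree integer. There exists a map $\sigma_m:\mathcal{W}_m^{(2)}\to\frac14W_0(\mathbb{Z})\subset\frac14W(\mathbb{Z})$ such that for every $f\in\mathcal{W}_m^{(2)}$: $f_{\sigma_m(f)}=f$; for every odd prime $p\mid m$, $p^2$ strongly divides $\Delta(\sigma_m(f))$ as an element of $\frac14W_0(\mathbb{Z})$; and $|Q(\sigma_m(f))|=m$.
   Context: $W$ is the space of symmetric $n\times n$ matrices, $W_0\subset W$ the subspace of matrices whose top-left $g\times(g+1)$ block is zero, and $\frac14W(\mathbb{Z})$, $\frac14W_0(\mathbb{Z})$ the elements with entries in $\frac14\mathbb{Z}$. $A_0$ is the $n\times n$ matrix with $1$'s on the anti-diagonal and $0$'s elsewhere; $f_B(x)=(-1)^{g+1}\det(A_0x-B)$ and $\Delta(B)=\Delta(f_B)$. For an odd prime $p$ and $B\in\frac14W_0(\mathbb{Z})$, ''$p^2$ strongly divides $\Delta(B)$ as an element of $\frac14W_0(\mathbb{Z})$'' means $v_p(\Delta(B+pC))\ge2$ for all $C\in\frac14W_0(\mathbb{Z})$. $Q$ on $W_0$: for $B\in W_0$ let $B^{\mathrm{top}}$, $A_0^{\mathrm{top}}$ be the top-right $g\times(g+1)$ blocks; for $g\times(g+1)$ matrices $(A,B')$ let $M(x,y)$ be the vector whose $i$-th entry is $(-1)^{i-1}$ times the determinant of $Ax-B'y$ with its $i$-th column deleted (a binary form of degree $g$), and $Q(A,B')$ the determinant of the $(g+1)\times(g+1)$ coefficient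 matrix of these forms; $Q(B)=Q(A_0^{\mathrm{top}},B^{\mathrm{top}})$. For monic integer $f$ of degree $n$: $p^2$ weakly divides $\Delta(f)$ if $p^2\mid\Delta(f)$ and $f\bmod p$ has exactly one multiple root, which lies in $\mathbb{F}_p$ and is a double root; $\mathcal{W}_m^{(2)}$ is the set of monic integer polynomials of degree $n$ whose discriminant is weakly divisible by $p^2$ for every prime $p\mid m$. *)

(* Defs.v *)
From HB Require Import structures.
From mathcomp Require Import all_boot all_order all_algebra.
Set Implicit Arguments. Unset Strict Implicit. Unset Printing Implicit Defensive.
Import Order.TTheory GRing.Theory Num.Theory.
Local Open Scope ring_scope.

Definition squarefree (m : nat) : Prop := forall d : nat, (d ^ 2 %| m)%N -> d = 1%N.

(* Discriminant of a monic polynomial of degree d.  The coefficients are taken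
   in a ring of characteristic 0, so that f^`() has degree exactly d - 1 and
   [resultant], whose size depends on the actual degrees, is Res(f, f'). *)
Definition discr (R : numDomainType) (f : {poly R}) : R :=
  let d := (size f).-1 in (-1) ^+ 'C(d, 2) * resultant f f^`().

Definition antidiag (R : comNzRingType) (n : nat) : 'M[R]_n :=
  \matrix_(i, j) (j == rev_ord i)%:R.

(* f_B(x) = (-1)^(g+1) det(A_0 x - B), for n = 2g + 2 *)
Definition fpoly (R : comNzRingType) (g : nat) (B : 'M[R]_(g.*2.+2)) : {poly R} :=
  (-1) ^+ g.+1 *
  \det ('X *: map_mx polyC (antidiag R g.*2.+2) - map_mx polyC B).

Definition in_W0 (R : comNzRingType) (g : nat) (B : 'M[R]_(g.*2.+2)) : Prop :=
  B^T = B /\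
  forall i j : 'I_(g.*2.+2), (i < g)%N -> (j < g.+1)%N -> B i j = 0.

Definition in_quarterW0Z (g : nat) (B : 'M[rat]_(g.*2.+2)) : Prop :=
  in_W0 B /\ forall i j, 4%:R * B i j \is a Num.int.

(* p-adic valuation of a nonzero rational; since logn p 0 = 0, the convention
   v_p(0) = +oo has to be added separately, as in [valp_ge]. *)
Definition valp (p : nat) (q : rat) : int :=
  (logn p `|numq q|)%:Z - (logn p `|denq q|)%:Z.

Definition valp_ge (p : nat) (k : int) (q : rat) : Prop :=
  q = 0 \/ k <= valp p q.

Definition strongly_divides (g p : nat) (B : 'M[rat]_(g.*2.+2)) : Prop :=
  forall C : 'M[rat]_(g.*2.+2), in_quarterW0Z C ->
    valp_ge p 2 (discr (fpoly (B + p%:R *: C))).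

Definition top_right (R : comNzRingType) (g : nat) (B : 'M[R]_(g.*2.+2)) :
    'M[R]_(g, g.+1) :=
  \matrix_(i < g, j < g.+1) B (inord i) (inord (g.+1 + j)).

(* Binary forms in x, y are polynomials in {poly {poly R}}, with x the outer
   variable 'X and y the inner variable 'X%:P. *)
Definition pencil_minor (R : comNzRingType) (g : nat) (A B : 'M[R]_(g, g.+1))
    (i : 'I_g.+1) : {poly {poly R}} :=
  let lift2 := map_mx (fun a : R => a%:P%:P) in
  (-1) ^+ i * \det (col' i ('X *: lift2 A - 'X%:P *: lift2 B) : 'M_g).

(* Row i holds the coefficients of x^j y^(g-j), 0 <= j <= g, of the i-th form. *)
Definition Qpair (R : comNzRingType) (g : nat) (A B : 'M[R]_(g, g.+1)) : R :=
  \det (\matrix_(i < g.+1, j < g.+1) ((pencil_minor A B i)`_j)`_(g - j)).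

Definition Qinv (R : comNzRingType) (g : nat) (B : 'M[R]_(g.*2.+2)) : R :=
  Qpair (top_right (antidiag R g.*2.+2)) (top_right B).

Definition reduce (p : nat) (f : {poly int}) : {poly 'F_p} :=
  map_poly (fun a : int => a%:~R) f.

(* The reduction of f mod p has r in F_p as a double root, and r is its only
   multiple root in an algebraically closed extension of F_p. *)
Definition unique_double_root (p : nat) (f : {poly int}) : Prop :=
  exists r : 'F_p, mup r (reduce p f) = 2%N /\
    forall (K : closedFieldType) (iota : {rmorphism 'F_p -> K}) (z : K),
      (2 <= mup z (map_poly iota (reduce p f)))%N -> z = iota r.

Definition weakly_divides (p : nat) (f : {poly int}) : Prop :=
  (p%:Z ^+ 2 %| discr f)%Z /\ unique_double_root p f.

Definition in_Wm2 (n m : nat) (f : {poly int}) : Prop :=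
  [/\ f \is monic, size f = n.+1 &
      forall p : nat, prime p -> (p %| m)%N -> weakly_divides p f].

(* Main.v *)
Require Import Defs.
From HB Require Import structures.
From mathcomp Require Import all_boot all_order all_algebra.
From mathcomp Require Import fingroup perm closed_field ring zify.
Set Implicit Arguments. Unset Strict Implicit. Unset Printing Implicit Defensive.
Import Order.TTheory GRing.Theory Num.Theory.
Local Open Scope ring_scope.

(** Let z = X - l, where l is an integer with m | 2 f'(l) and m^2 | 4 f(l), and
   expand f = sum_k h_k z^k.  The matrix sigma(f) is l A_0 plus a sparse matrix
   whose top-right g x (g+1) block gives the pencil with kernel
   w = (z^g, ..., z, m); its remaining entries are read off the h_k, with
   h_1 / 2m and h_0 / m^2 compensating the last coordinate of w.
   - The pencil minors are z^(g-i) y^i up to sign, the last one times m, so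
     their coefficient matrix is triangular and |Q| = m.
   - Extending w by elimination gives a vector y with (A_0 X - B) y = (f/m) e_n
     and y_n = m, so the adjugate shows that f divides det (A_0 X - B); both
     are monic of degree n up to sign.
   - For odd p | m, the first row and column of A_0 X - (B + p C) lie in the ideal
     (p, X - l) and the corner vanishes, hence the determinant F lies in
     (p, X - l)^2, that is p^2 | F(l) and p | F'(l).
   - Dividing a column of the Sylvester matrix by p shows that p^2 | Res(F, F')
     is a linear condition on the syzygies of (F, F') modulo p.  It follows from
     p^2 | F(l) and p | F'(l); conversely, for f with a unique double root r
     modulo p, it forces p^2 | f(l) for l lifting r.  This is where l comes from,
     using the Chinese remainder theorem; at p = 2 there is no constraint on l
     thanks to the denominators 4. *)

(** * Resultants modulo the square of a prime *)

(** Rows of the Sylvester matrix, kept as polynomials: they can then be evaluated at a point before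
    their coefficients are read off. *)
Definition sylvester_row (R : nzRingType) (d e : nat) (p q : {poly R})
    (i : 'I_(e + d)) : {poly R} :=
  match split i with inl k => 'X^k * p | inr k => 'X^k * q end.

Lemma resultantE (R : nzRingType) (p q : {poly R}) :
  resultant p q =
    \det (\matrix_(i, j < (size q).-1 + (size p).-1) (sylvester_row p q i)`_j).
Proof.
congr (\det _); apply/matrixP=> i j; rewrite Sylvester_mxE !mxE /sylvester_row.
by case: (split i) => k; rewrite coefXnM ltnNge; case: leqP.
Qed.

Lemma resultantZ (R : idomainType) (c : R) (p q : {poly R}) : c != 0 ->
  resultant (c *: p) (c *: q) =
    c ^+ ((size q).-1 + (size p).-1) * resultant p q.
Proof.
move=> c0; rewrite !resultantE !size_scale // -detZ; congr (\det _).
apply/matrixP=> i j; rewrite !mxE /sylvester_row.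
by case: (split i) => k; rewrite -scalerAr coefZ.
Qed.

Lemma size_sylvester_row (R : nzRingType) (p q : {poly R})
    (i : 'I_((size q).-1 + (size p).-1)) :
  (size (sylvester_row p q i) <= (size q).-1 + (size p).-1)%N.
Proof.
have aux (r : {poly R}) (k d : nat) : (k < d)%N ->
    (size ('X^k * r)%R <= d + (size r).-1)%N.
  move=> lt_kd; have [->|r0] := eqVneq r 0; first by rewrite mulr0 size_poly0.
  have -> : 'X^k * r = r * 'X^k by apply/esym/commr_polyXn.
  rewrite size_mulXn //.
  by rewrite (polySpred r0) -addSnnS leq_add2r.
rewrite /sylvester_row; case: splitP => k _; first exact: aux.
by rewrite addnC; apply: aux.
Qed.

(** A left multiplier of the matrix is a pair of cofactors of bounded degree, so its left kernel
    consists of the syzygies of [(p, q)] in that range. *)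
Lemma sum_sylvester_row (R : comNzRingType) (d e : nat) (p q : {poly R})
    (u : 'I_(e + d) -> R) :
  \sum_i (u i)%:P * sylvester_row p q i =
    (\sum_(k < e) u (lshift d k) *: 'X^k) * p +
    (\sum_(k < d) u (rshift e k) *: 'X^k) * q.
Proof.
rewrite big_split_ord !mulr_suml /=; congr (_ + _); apply: eq_bigr => k _;
  rewrite /sylvester_row; case: splitP => j /=.
- by move/val_inj<-; rewrite mul_polyC scalerAl.
- by move=> kE; have := ltn_ord k; rewrite kE ltnNge leq_addr.
- by move=> kE; have := ltn_ord j; rewrite -kE ltnNge leq_addr.
- by move/eqP; rewrite eqn_add2l => /eqP/val_inj<-; rewrite mul_polyC scalerAl.
Qed.

(* Replacing the constant coefficients in the first column of the Sylvester
   matrix by values at [l] is a unimodular column operation; afterwards that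
   column is divisible by [p] and what remains is a condition modulo [p]. *)
Lemma sqr_dvd_resultantP (p : nat) (P Q : {poly int}) (l a b : int) :
    prime p -> (1 < size P)%N -> P.[l] = p%:Z * a -> Q.[l] = p%:Z * b ->
  (p%:Z ^+ 2 %| resultant P Q)%Z <->
  exists uv : {poly 'F_p} * {poly 'F_p},
    [/\ uv != (0, 0), (size uv.1 <= (size Q).-1)%N,
        (size uv.2 <= (size P).-1)%N,
        uv.1 * reduce p P + uv.2 * reduce p Q = 0 &
        uv.1.[l%:~R] * a%:~R + uv.2.[l%:~R] * b%:~R = 0].
Proof.
move=> pr_p sP Pl Ql; have p0 : p%:Z != 0 by case: p pr_p {Pl Ql}.
set e := (size Q).-1; set d := (size P).-1.
have d0 : (0 < d)%N by rewrite /d; case: (size P) sP => [|[]].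
have D0 : (0 < e + d)%N by rewrite addn_gt0 d0 orbT.
pose o : 'I_(e + d) := Ordinal D0.
pose s (i : 'I_(e + d)) := sylvester_row P Q i.
pose S : 'M[int]_(e + d) := \matrix_(i, j) (s i)`_j.
pose V : 'M[int]_(e + d) := \matrix_(i, j) if j == o then l ^+ i else (i == j)%:R.
pose col0 (i : 'I_(e + d)) : int :=
  match split i with inl k => l ^+ k * a | inr k => l ^+ k * b end.
pose E : 'M[int]_(e + d) := \matrix_(i, j) if j == o then col0 i else (s i)`_j.
pose T : 'M[int]_(e + d) := diag_mx (\row_j if j == o then p%:Z else 1).
have detV : \det V = 1.
  rewrite det_trig; last first.
    apply/is_trig_mxP=> i j lt_ij; rewrite mxE.
    case: eqP => [jo|_]; first by rewrite jo in lt_ij.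
    by case: eqP => // ij; rewrite ij ltnn in lt_ij.
  by rewrite big1 // => i _; rewrite mxE eqxx; case: eqP => // ->; rewrite expr0.
have detT : \det T = p%:Z.
  rewrite det_diag (bigD1 o) //= big1 => [|i /negPf io]; rewrite mxE ?io //.
  by rewrite eqxx mulr1.
have SV : S *m V = E *m T.
  apply/matrixP=> i j; rewrite mul_mx_diag !mxE.
  case: (eqVneq j o) => [->|jo]; last first.
    rewrite (bigD1 j) //= big1 => [|k /negPf kj]; rewrite !mxE (negPf jo) ?kj ?mulr0//.
    by rewrite eqxx addr0.
  transitivity ((s i).[l]).
    rewrite (horner_coef_wide _ (size_sylvester_row i)).
    by apply: eq_bigr => k _; rewrite !mxE eqxx.
  rewrite /s /sylvester_row /col0; case: (split i) => k;
    by rewrite hornerM hornerXn ?Pl ?Ql mulrCA mulrC.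
have -> : resultant P Q = \det S by rewrite resultantE.
rewrite -[\det S]mulr1 -{1}detV -det_mulmx SV det_mulmx detT expr2 dvdz_mul2r //.
have -> : (p%:Z %| \det E)%Z = (\det (map_mx (intr : int -> 'F_p) E) == 0).
  by rewrite det_map_mx /= (dvdz_pcharf (pchar_Fp pr_p)).
pose pol n (w : 'I_n -> 'F_p) : {poly 'F_p} := \sum_(k < n) w k *: 'X^k.
have size_pol n w : (size (@pol n w) <= n)%N.
  apply: (leq_trans (size_sum _ _ _)); apply/bigmax_leqP=> k _.
  by rewrite (leq_trans (size_scale_leq _ _)) // size_polyXn.
have coef_pol n w (k : 'I_n) : (@pol n w)`_k = w k.
  rewrite coef_sum (bigD1 k) //= big1 => [|j jk]; rewrite coefZ coefXn.
    by rewrite eqxx mulr1 addr0.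
  by rewrite (inj_eq val_inj) eq_sym (negPf jk) mulr0.
(* Modulo [p], the columns of [E] other than [o] still give the coefficients of positive degree of
   the combination; column [o] gives the extra condition. *)
have kerE (w : 'rV['F_p]_(e + d)) :
    let u := pol e (fun k => w 0 (lshift d k)) in
    let v := pol d (fun k => w 0 (rshift e k)) in
    (w *m map_mx (intr : int -> 'F_p) E == 0) =
    (u * reduce p P + v * reduce p Q == 0) &&
    (u.[l%:~R] * a%:~R + v.[l%:~R] * b%:~R == 0).
  move=> u v.
  have lin : u * reduce p P + v * reduce p Q =
      \sum_i (w 0 i)%:P * map_poly intr (s i).
    rewrite /u /v /pol -(sum_sylvester_row _ _ (fun i => w 0 i)).
    apply: eq_bigr => i _; rewrite /s /sylvester_row /reduce.
    by case: (split i) => k; rewrite rmorphM /= map_polyXn.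
  have sz : (size (u * reduce p P + v * reduce p Q)%R <= e + d)%N.
    rewrite lin (leq_trans (size_sum _ _ _)) //; apply/bigmax_leqP=> i _.
    rewrite mul_polyC (leq_trans (size_scale_leq _ _)) //.
    by rewrite (leq_trans (size_poly _ _)) // size_sylvester_row.
  have c0 : (w *m map_mx (intr : int -> 'F_p) E) 0 o =
      u.[l%:~R] * a%:~R + v.[l%:~R] * b%:~R.
    rewrite mxE big_split_ord /u /v /pol !horner_sum !mulr_suml /=.
    congr (_ + _); apply: eq_bigr => k _; rewrite !mxE eqxx /col0;
      case: splitP => j /=.
    - by move/val_inj<-; rewrite hornerZ hornerXn rmorphM rmorphXn /= mulrA.
    - by move=> kE; have := ltn_ord k; rewrite kE ltnNge leq_addr.
    - by move=> kE; have := ltn_ord j; rewrite -kE ltnNge leq_addr.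
    - move/eqP; rewrite eqn_add2l => /eqP/val_inj<-.
      by rewrite hornerZ hornerXn rmorphM rmorphXn /= mulrA.
  have cj j : j != o -> (w *m map_mx (intr : int -> 'F_p) E) 0 j =
      (u * reduce p P + v * reduce p Q)`_j.
    move=> /negPf jo; rewrite lin coef_sum mxE; apply: eq_bigr => i _.
    by rewrite !mxE jo coefCM coef_map.
  (* The constant coefficient is no longer visible in [E]. Once the other coefficients vanish, it
     equals the value at [l], which is 0 because [p] divides both [P.[l]] and [Q.[l]]. *)
  have ev : (u * reduce p P + v * reduce p Q).[l%:~R] = 0.
    rewrite hornerD !hornerM /reduce !horner_map /= Pl Ql !rmorphM /=.
    have -> : (p%:Z)%:~R = 0 :> 'F_p by rewrite -pmulrn pcharf0 ?pchar_Fp.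
    by rewrite !mul0r !mulr0 addr0.
  apply/eqP/andP => [w0|[/eqP uv0 /eqP ab0]]; last first.
    apply/rowP=> j; rewrite [RHS]mxE.
    by case: (eqVneq j o) => [->|jo]; rewrite ?c0 // cj // uv0 coef0.
  split; last by rewrite -c0 w0 mxE.
  suff /size1_polyC E0 : (size (u * reduce p P + v * reduce p Q)%R <= 1)%N.
    by move: ev; rewrite E0 hornerC => ->.
  apply/leq_sizeP=> j j0; have [jl|jl] := ltnP j (e + d).
    by rewrite -(cj (Ordinal jl)) ?w0 ?mxE // -val_eqE /= -lt0n.
  by rewrite nth_default // (leq_trans sz).
split=> [/det0P[w w0 wE]|[[u v] /= [uv0 su sv uvE abE]]].
  have := kerE w; rewrite wE eqxx => /esym/andP[/eqP e1 /eqP e2].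
  exists (pol e (fun k => w 0 (lshift d k)), pol d (fun k => w 0 (rshift e k))).
  split=> //=; apply: contraNneq w0 => -[/= u0 v0]; apply/eqP/rowP=> i.
  rewrite mxE -[i]splitK; case: (split i) => k /=.
    by rewrite -(coef_pol e (fun k => w 0 (lshift d k))) u0 coef0.
  by rewrite -(coef_pol d (fun k => w 0 (rshift e k))) v0 coef0.
have polK n (r : {poly 'F_p}) : (size r <= n)%N -> pol n (fun k => r`_k) = r.
  move=> sr; apply/polyP=> j; have [jn|jn] := ltnP j n.
    by rewrite (coef_pol _ _ (Ordinal jn)).
  by rewrite !nth_default // (leq_trans _ jn).
pose w : 'rV['F_p]_(e + d) := row_mx (\row_k u`_k) (\row_k v`_k).
have wu : pol e (fun k => w 0 (lshift d k)) = u.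
  by rewrite -[RHS](polK e) //; apply: eq_bigr => k _; rewrite row_mxEl mxE.
have wv : pol d (fun k => w 0 (rshift e k)) = v.
  by rewrite -[RHS](polK d) //; apply: eq_bigr => k _; rewrite row_mxEr mxE.
apply/det0P; exists w; last by apply/eqP; rewrite kerE wu wv uvE abE !eqxx.
apply: contraNneq uv0 => w0; rewrite -wu -wv w0 /pol.
by rewrite !big1 // => k _; rewrite mxE scale0r.
Qed.

(** * Double roots modulo p and the discriminant *)

Lemma double_root_factor (F : fieldType) (f : {poly F}) (r : F) :
  root f r -> root f^`() r -> exists k, f = k * ('X - r%:P) ^+ 2.
Proof.
case/factor_theorem=> q ->; rewrite derivM derivXsubC mulr1 rootE !hornerE.
rewrite subrr mulr0 add0r => /factor_theorem[k ->].
by exists k; rewrite -mulrA expr2.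
Qed.

Lemma deriv_mul_sqrXsubC (R : comNzRingType) (k : {poly R}) (r : R) :
  (k * ('X - r%:P) ^+ 2)^`() =
    (k *+ 2 + k^`() * ('X - r%:P)) * ('X - r%:P).
Proof.
by rewrite derivM expr2 derivM derivXsubC; ring.
Qed.

Lemma algebraic_closure_Fp (p : nat) :
  exists K : closedFieldType, inhabited {rmorphism 'F_p -> K}.
Proof.
have [K [iota _]] := countable_algebraic_closure 'F_p.
by exists K; constructor; exact: iota.
Qed.

Lemma two_neq0_Fp (p : nat) : prime p -> odd p -> 2%:R != 0 :> 'F_p.
Proof.
move=> pr_p odd_p; rewrite -(dvdn_pcharf (pchar_Fp pr_p)) dvdn_prime2 //.
by apply: contraTneq odd_p => ->.
Qed.

(** These are the cofactors of ['X - r] in [f = k (X - r)^2] and in [f']. A common root in the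
    closure is either [r], where the second one takes the value [2 k(r) != 0], or a root of both [k]
    and [k'], hence a second multiple root of [f]. *)
Lemma coprime_cofactor_deriv (p : nat) (k : {poly 'F_p}) (r : 'F_p) :
    prime p -> odd p -> ~~ root k r ->
    (forall (K : closedFieldType) (iota : {rmorphism 'F_p -> K}) (z : K),
       (2 <= mup z (map_poly iota (k * ('X - r%:P) ^+ 2)))%N -> z = iota r) ->
  coprimep (k * ('X - r%:P)) (k *+ 2 + k^`() * ('X - r%:P)).
Proof.
move=> pr_p odd_p kr uniq_r; have [K [iota]] := algebraic_closure_Fp p.
have k0 : k != 0 by apply: contraNneq kr => ->; rewrite root0.
have two0 := two_neq0_Fp pr_p odd_p.
rewrite -(coprimep_map iota) /coprimep; apply: contraT => /closed_rootP[z].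
rewrite root_gcd !rmorphM /= map_polyXsubC rmorphD rmorphMn rmorphM /= map_polyXsubC.
rewrite rootM root_XsubC.
case/andP=> /orP[kz|/eqP->]; last first.
  rewrite rootE !hornerE subrr mulr0 addr0. rewrite -mulr2n horner_map -rmorphMn /= fmorph_eq0.
  by rewrite -mulr_natr mulf_eq0 (negPf two0) orbF -rootE (negPf kr).
rewrite rootE !hornerE (rootP kz) !add0r mulf_eq0 subr_eq0.
have zr : z != iota r.
  by apply: contraNneq kr => zr; move: kz; rewrite zr fmorph_root.
rewrite (negPf zr) orbF -deriv_map -rootE => kz'.
have [q kE] := double_root_factor kz kz'.
case/eqP: zr; apply: uniq_r; rewrite mup_geq.
  by rewrite rmorphM /= kE -mulrA mulrCA dvdp_mulr.
by rewrite map_poly_eq0 mulf_neq0 // expf_neq0 ?polyXsubC_eq0.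
Qed.

Lemma dvdz_signl (d x : int) (n : nat) : (d %| (-1) ^+ n * x)%Z = (d %| x)%Z.
Proof. by rewrite !dvdzE abszMsign. Qed.

(** Let [l] lift [r] and [f(l) = p a]. Since [p^2] divides the discriminant, [(f, f')] has a nonzero
    syzygy modulo [p] that meets the linear condition. By coprimality and the degree bounds it is a
    constant multiple of [(- G, k (X - r))]. Its second component vanishes at [r] while
    [G(r) = 2 k(r)] does not, so the condition forces [a = 0] modulo [p]. *)
Lemma weakly_divides_root (p : nat) (f : {poly int}) :
    prime p -> odd p -> f \is monic -> (1 < size f)%N -> weakly_divides p f ->
  exists l : int, (p%:Z %| f^`().[l])%Z /\ (p%:Z ^+ 2 %| f.[l])%Z.
Proof.
move=> pr_p odd_p mon_f sf [disc [r [mup_r uniq_r]]].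
have charF := pchar_Fp pr_p.
have sz_fb : size (reduce p f) = size f.
  by apply: size_map_poly_id0; rewrite (monicP mon_f) oner_eq0.
have fb0 : reduce p f != 0.
  by rewrite -size_poly_gt0 sz_fb (leq_trans _ sf).
have /dvdpP[k fE] : ('X - r%:P) ^+ 2 %| reduce p f by rewrite -mup_geq // mup_r.
have kr : ~~ root k r.
  have : ~~ (('X - r%:P) ^+ 3 %| reduce p f) by rewrite -mup_leq // mup_r.
  by apply: contra => /factor_theorem[q kE]; rewrite fE kE -mulrA -exprS dvdp_mull.
rewrite fE in uniq_r; have := coprime_cofactor_deriv pr_p odd_p kr uniq_r.
pose l : int := (r : nat)%:Z.
have lr : l%:~R = r by rewrite -pmulrn natr_Zp.
set G := k *+ 2 + _ => copr.
have f'E : reduce p f^`() = G * ('X - r%:P).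
  by rewrite /reduce -deriv_map -/(reduce p f) fE deriv_mul_sqrXsubC.
have /dvdzP[a aE] : (p%:Z %| f.[l])%Z.
  rewrite (dvdz_pcharf charF) -horner_map /= -/(reduce p f) fE lr.
  by rewrite !(hornerM, horner_exp) hornerXsubC subrr !mulr0.
have /dvdzP[b bE] : (p%:Z %| f^`().[l])%Z.
  rewrite (dvdz_pcharf charF) -horner_map /= -/(reduce p _) f'E lr.
  by rewrite !hornerE subrr mulr0.
rewrite mulrC in aE; rewrite mulrC in bE.
exists l; split; first by rewrite bE dvdz_mulr.
rewrite aE expr2 dvdz_mul2l; last by case: p pr_p {disc r mup_r uniq_r charF sz_fb fb0 fE kr k l lr G copr f'E aE bE odd_p}.
rewrite (dvdz_pcharf charF); apply: contraT => a0; exfalso.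
have := disc; rewrite /discr dvdz_signl => /(sqr_dvd_resultantP pr_p sf aE bE).
case=> -[u v] /= [uv0 su sv]; rewrite fE f'E expr2 !mulrA -mulrDl => /eqP.
rewrite mulf_eq0 polyXsubC_eq0 orbF -mulrA addr_eq0 => /eqP uvE.
rewrite lr => abE.
have : (k * ('X - r%:P)) %| v.
  by rewrite -(Gauss_dvdpl _ copr) -dvdpNr -uvE dvdp_mull.
case/dvdpP=> w vE.
have kX0 : k * ('X - r%:P) != 0.
  by rewrite mulf_neq0 ?polyXsubC_eq0 //; apply: contraNneq kr => ->; rewrite root0.
have uE : u = - (w * G).
  by apply: (mulIf kX0); rewrite uvE vE mulNr mulrAC.
have w0 : w != 0.
  by apply: contraNneq uv0 => w0; rewrite uE vE w0 !mul0r oppr0.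
(* [k (X - r)] already has the largest size allowed for [v], so the quotient is a constant. *)
have sw : (size w <= 1)%N.
  have skX : size (k * ('X - r%:P)) = (size f).-1.
    by rewrite -sz_fb fE expr2 mulrA [in RHS]size_Mmonic ?monicXsubC // size_XsubC addn2.
  have := sv; rewrite vE size_mul // skX; move: sf; case: (size f) => [|[|s]] //= _.
  by rewrite addnS /= -[X in (_ <= X)%N]add1n leq_add2r.
have [c cE] : exists c, w = c%:P by exists w`_0; exact: size1_polyC.
move/eqP: abE; rewrite uE vE cE hornerN !hornerM hornerXsubC subrr !mulr0 mul0r.
rewrite addr0 hornerC mulNr oppr_eq0 !mulf_eq0 (negPf a0) orbF.
move: w0; rewrite cE polyC_eq0 => /negPf->.
rewrite /G hornerD hornerMn hornerM hornerXsubC subrr mulr0 addr0 -mulr_natr.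
by rewrite mulf_eq0 (negPf (two_neq0_Fp pr_p odd_p)) orbF -rootE (negPf kr).
Qed.

(** Modulo [p], the pair [(- F' / (X - l), F / (X - l))] is a syzygy. It meets the linear condition
    because [F(l) / p] is again divisible by [p] and the second component vanishes at the double
    root [l]. *)
Lemma sqr_dvd_resultant_deriv (p : nat) (F : {poly int}) (l : int) :
    prime p -> (1 < size F)%N -> reduce p F != 0 ->
    (p%:Z ^+ 2 %| F.[l])%Z -> (p%:Z %| F^`().[l])%Z ->
  (p%:Z ^+ 2 %| resultant F F^`())%Z.
Proof.
move=> pr_p sF F0 /dvdzP[a aE] /dvdzP[b bE]; have charF := pchar_Fp pr_p.
have p0 : (p%:Z)%:~R = 0 :> 'F_p by rewrite -pmulrn pcharf0.
have rF : root (reduce p F) l%:~R.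
  by rewrite rootE horner_map /= aE expr2 !rmorphM /= p0 !mulr0.
have rF' : root (reduce p F)^`() l%:~R.
  by rewrite rootE deriv_map horner_map /= bE rmorphM /= p0 mulr0.
have [k kE] := double_root_factor rF rF'.
have F'E : reduce p F^`() = (k *+ 2 + k^`() * ('X - l%:~R%:P)) * ('X - l%:~R%:P).
  by rewrite /reduce -deriv_map -/(reduce p F) kE deriv_mul_sqrXsubC.
have size_dvd (q r : {poly 'F_p}) (P : {poly int}) :
    reduce p P = q * ('X - r) -> ('X - r) \is monic -> size ('X - r) = 2%N ->
    (size q <= (size P).-1)%N.
  move=> PE mon_r sr; have [->|q0] := eqVneq q 0; first by rewrite size_poly0.
  have : (size (reduce p P) <= size P)%N by apply: size_poly.
  rewrite PE size_Mmonic // sr addn2 /=.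
  by case: (size P).
rewrite (mulrC b) in bE; have aE' : F.[l] = p%:Z * (a * p%:Z).
  by rewrite aE expr2 mulrCA mulrC.
apply/(sqr_dvd_resultantP pr_p sF aE' bE).
exists (- (k *+ 2 + k^`() * ('X - l%:~R%:P)), k * ('X - l%:~R%:P)) => /=.
have mon_l := monicXsubC (l%:~R : 'F_p).
have kX : k * ('X - l%:~R%:P) != 0.
  by apply: contraNneq F0 => kX0; rewrite kE expr2 mulrA kX0 mul0r.
split.
- by apply: contraNneq kX => -[_ ->].
- by rewrite size_polyN; apply: (size_dvd _ _ _ F'E); rewrite ?size_XsubC.
- by apply: (size_dvd _ l%:~R%:P); rewrite ?size_XsubC // kE expr2 mulrA.
- by rewrite kE F'E; ring.
- by rewrite rmorphM /= p0 !mulr0 hornerM hornerXsubC subrr mulr0 mul0r addr0.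
Qed.

(** * The shift l *)

Lemma dvdz_horner_sub (f : {poly int}) (k x y : int) :
  (k %| x - y -> k %| f.[x] - f.[y])%Z.
Proof.
have : root (f - f.[y]%:P) y by rewrite rootE !hornerE subrr.
case/factor_theorem=> q fE kxy.
have -> : f.[x] - f.[y] = q.[x] * (x - y).
  by rewrite -(hornerXsubC y x) -hornerM -fE !hornerE.
exact: dvdz_mull.
Qed.

(** For [k = m] this says that [f'(l) / 2m] and [f(l) / m^2] are quarter integers. The factors 2 and
    4 are units at odd primes and make the condition automatic for [k = 2]. *)
Definition good_shift (f : {poly int}) (k l : int) : bool :=
  (k %| 2%:Z * f^`().[l])%Z && (k ^+ 2 %| 4%:Z * f.[l])%Z.

Lemma good_shift_mod (f : {poly int}) (k x y : int) :
  (k ^+ 2 %| x - y)%Z -> good_shift f k y -> good_shift f k x.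
Proof.
move=> kxy /andP[d1 d2]; apply/andP; split.
  rewrite -[f^`().[x]](subrK f^`().[y]) mulrDr rpredD // dvdz_mull //.
  by apply: dvdz_horner_sub; apply: dvdz_trans kxy; rewrite expr2 dvdz_mulr.
rewrite -[f.[x]](subrK f.[y]) mulrDr rpredD // dvdz_mull //.
exact: dvdz_horner_sub.
Qed.

Lemma good_shift_mul (f : {poly int}) (k1 k2 l1 l2 : int) :
    coprimez k1 k2 -> good_shift f k1 l1 -> good_shift f k2 l2 ->
  exists l, good_shift f (k1 * k2) l.
Proof.
move=> co g1 g2.
have co2 : coprimez (k1 ^+ 2) (k2 ^+ 2) by rewrite coprimezXl // coprimezXr.
pose l := zchinese (k1 ^+ 2) (k2 ^+ 2) l1 l2.
have e1 : (k1 ^+ 2 %| l - l1)%Z by rewrite -eqz_mod_dvd; apply/eqP/zchinese_modl.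
have e2 : (k2 ^+ 2 %| l - l2)%Z by rewrite -eqz_mod_dvd; apply/eqP/zchinese_modr.
exists l; have /andP[a1 b1] := good_shift_mod e1 g1.
have /andP[a2 b2] := good_shift_mod e2 g2.
by rewrite /good_shift exprMn (Gauss_dvdz _ co) (Gauss_dvdz _ co2) a1 b1 a2 b2.
Qed.

Lemma prod_primes_squarefree (m : nat) :
  (0 < m)%N -> squarefree m -> m = (\prod_(p <- primes m) p)%N.
Proof.
move=> m0 sf; rewrite [LHS]prod_prime_decomp // prime_decompE big_map /=.
rewrite !big_seq; apply: eq_bigr => p; rewrite mem_primes => /and3P[pr_p _ pm].
suff -> : logn p m = 1%N by rewrite expn1.
apply/eqP; rewrite eqn_leq logn_gt0 mem_primes pr_p m0 pm /= andbT leqNgt.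
apply/negP=> l2; have := sf p; rewrite pfactor_dvdn // => /(_ l2) p1.
by rewrite p1 in pr_p.
Qed.

Lemma exists_good_shift (m : nat) (f : {poly int}) :
    (0 < m)%N -> squarefree m -> f \is monic -> (1 < size f)%N ->
    (forall p, prime p -> (p %| m)%N -> weakly_divides p f) ->
  exists l, good_shift f m%:Z l.
Proof.
move=> m0 sfm mon_f sf wd.
have loc p : p \in primes m -> exists l, good_shift f p%:Z l.
  rewrite mem_primes => /and3P[pr_p _ pm].
  have [odd_p|even_p] := boolP (odd p).
    have [l [d1 d2]] := weakly_divides_root pr_p odd_p mon_f sf (wd p pr_p pm).
    by exists l; rewrite /good_shift !dvdz_mull.
  case: (even_prime pr_p) even_p => [->|->] // _.
  by exists 0; rewrite /good_shift !dvdz_mulr.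
suff: exists l, good_shift f (\prod_(p <- primes m) p)%N%:Z l.
  by rewrite -prod_primes_squarefree.
have := primes_uniq m; have : all prime (primes m).
  by apply/allP=> p; rewrite mem_primes => /andP[].
elim: (primes m) loc => [|p s IHs] loc /=.
  by rewrite big_nil => _ _; exists 0; rewrite /good_shift !dvd1z.
case/andP=> pr_p pr_s /andP[ps us]; rewrite big_cons PoszM.
have [l1 g1] := loc p (mem_head p s).
have [|l2 g2] := IHs _ pr_s us; first by move=> q qs; apply: loc; rewrite inE qs orbT.
apply: good_shift_mul g1 g2.
rewrite coprimezE /= prime_coprime //.
rewrite big_seq; elim/big_rec: _ => [|q x qs IH].
  by rewrite dvdn1; apply: contraL pr_p => /eqP->.
rewrite Euclid_dvdM // negb_or IH andbT dvdn_prime2 //; last exact: (allP pr_s).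
by apply: contraNneq ps => pq; rewrite pq.
Qed.

(** * Strong divisibility *)

Lemma antidiag_sqr (R : comNzRingType) (n : nat) :
  antidiag R n *m antidiag R n = 1%:M.
Proof.
apply/matrixP=> i j; rewrite !mxE (bigD1 (rev_ord i)) //= big1 => [|k /negPf ki].
  by rewrite !mxE eqxx rev_ordK mul1r addr0 eq_sym.
by rewrite !mxE ki mul0r.
Qed.

Lemma antidiag_tr (R : comNzRingType) (n : nat) : (antidiag R n)^T = antidiag R n.
Proof.
apply/matrixP=> i j; rewrite !mxE; congr (_%:R).
by rewrite -(inj_eq rev_ord_inj) rev_ordK eq_sym.
Qed.

Lemma det_antidiag (R : comNzRingType) (n : nat) :
  \det (antidiag R n) = (-1) ^+ 'C(n, 2).
Proof.
elim: n => [|n IHn]; first by rewrite det_mx00 expr0.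
rewrite (expand_det_row _ ord0) (bigD1 ord_max) //= big1 => [|j /negPf j_max].
  rewrite /cofactor !mxE add0n binS bin1 exprD -IHn addr0.
  have -> : (ord_max == rev_ord (@ord0 n)) by rewrite -val_eqE /= subn1.
  rewrite mul1r mulrC; congr (\det _ * _).
  apply/matrixP=> i j; rewrite !mxE -!val_eqE /= /bump leq0n add1n subSS.
  by rewrite leqNgt ltn_ord add0n.
rewrite mxE -val_eqE /= subn1 /=; move: j_max; rewrite -val_eqE /= => ->.
by rewrite mul0r.
Qed.

(** The binomial is [(g + 1)(2g + 1)]; hence the sign in [fpoly] is the determinant of
    [antidiag]. *)
Lemma odd_bin2 (g : nat) : odd 'C(g.*2.+2, 2) = odd g.+1.
Proof.
rewrite -[g.*2.+2]/(g.+1).*2 bin2 -doubleMl doubleK oddM.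
by rewrite doubleS /= odd_double andbT.
Qed.

(** The sign is [det A_0] and [A_0^2 = 1], so multiplying the pencil by [A_0] gives [X - A_0 B].
    Monicity and degree of [fpoly] come from here. *)
Lemma fpoly_char_poly (R : comNzRingType) (g : nat) (B : 'M[R]_(g.*2.+2)) :
  fpoly B = char_poly (antidiag R _ *m B).
Proof.
rewrite /fpoly /char_poly /char_poly_mx map_mxM -signr_odd -odd_bin2 signr_odd.
have <- : \det (map_mx polyC (antidiag R g.*2.+2)) = (-1) ^+ 'C(g.*2.+2, 2).
  by rewrite det_map_mx det_antidiag rmorph_sign.
rewrite -det_mulmx mulmxBr -scalemxAr.
by rewrite -(map_mxM _ (antidiag R _) (antidiag R _)) antidiag_sqr map_mx1 scalemx1.
Qed.

Lemma fpoly_monic (R : comNzRingType) (g : nat) (B : 'M[R]_(g.*2.+2)) :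
  fpoly B \is monic.
Proof. by rewrite fpoly_char_poly char_poly_monic. Qed.

Lemma size_fpoly (R : comNzRingType) (g : nat) (B : 'M[R]_(g.*2.+2)) :
  size (fpoly B) = g.*2.+3.
Proof. by rewrite fpoly_char_poly size_char_poly. Qed.

(* The two factors of each Leibniz term taken from row and column [0] lie in
   the ideal [(p, 'X - l)], so the determinant lies in its square. *)
Lemma det_sqr_ideal (n : nat) (p l : int) (M : 'M[{poly int}]_n.+1) :
    M ord0 ord0 = 0 -> (forall j, (p %| (M ord0 j).[l])%Z) ->
    (forall i, (p %| (M i ord0).[l])%Z) ->
  (p ^+ 2 %| (\det M).[l])%Z /\ (p %| (\det M)^`().[l])%Z.
Proof.
move=> M00 row0 col0.
suff term (s : 'S_n.+1) : let t := (-1) ^+ s * \prod_i M i (s i) in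
    (p ^+ 2 %| t.[l])%Z /\ (p %| t^`().[l])%Z.
  rewrite /determinant linear_sum !horner_sum /=; split; apply: rpred_sum => s _;
    by case: (term s).
have [s0|s0] := eqVneq (s ord0) ord0.
  rewrite /= (bigD1 ord0) //= s0 M00 mul0r mulr0 derivC !hornerC.
  by split; apply: dvdz0.
have i0 : (s^-1)%g ord0 != ord0 by rewrite -(inj_eq (@perm_inj _ s)) permKV eq_sym.
rewrite /= (bigD1 ord0) //= (bigD1 ((s^-1)%g ord0)) //= permKV.
set c := \prod_(i | _) _; set a := M ord0 _; set b := M _ ord0.
rewrite [a * _]mulrA [a * b * c]mulrC mulrA.
have pa : (p %| a.[l])%Z by apply: row0.
have pb : (p %| b.[l])%Z by apply: col0.
split; first by rewrite !hornerM dvdz_mull // expr2 dvdz_mul.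
set e := _ * c; rewrite derivM (derivM a) !(hornerD, hornerM).
apply: rpredD; first exact/dvdz_mull/dvdz_mulr.
by apply: dvdz_mull; apply: rpredD; [exact: dvdz_mull | exact: dvdz_mulr].
Qed.

Lemma resultant_intr (p q : {poly int}) :
  resultant (map_poly (intr : int -> rat) p) (map_poly intr q) =
    (resultant p q)%:~R.
Proof.
have sz (r : {poly int}) : size (map_poly (intr : int -> rat) r) = size r.
  by apply: size_map_inj_poly => //; apply: intr_inj.
rewrite !resultantE !sz -det_map_mx; congr (\det _); apply/matrixP=> i j.
rewrite !mxE /sylvester_row -coef_map.
by case: (split i) => k; rewrite rmorphM /= map_polyXn.
Qed.

(** For odd [p] the powers of 4 cleared from the denominators have valuation 0. *)
Lemma valp_ge_quarter (p N : nat) (q : rat) (z : int) :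
    prime p -> odd p -> 4%:R ^+ N * q = (p%:Z ^+ 2 * z)%:~R ->
  valp_ge p 2 q.
Proof.
move=> pr_p odd_p qE; have [->|q0] := eqVneq q 0; [by left | right].
have numE : 4%:Z ^+ N * numq q = p%:Z ^+ 2 * z * denq q.
  apply: (@intr_inj rat); rewrite [RHS]rmorphM /= -qE rmorphM rmorphXn /=.
  by rewrite -{2}[q]divq_num_den mulrA divfK // intr_eq0 denq_neq0.
have num0 : (0 < `|numq q|)%N by rewrite absz_gt0 numq_eq0.
have den0 : (0 < `|denq q|)%N by rewrite absz_gt0 denq_neq0.
have z0 : (0 < `|z|)%N.
  rewrite absz_gt0; apply/eqP => z0; move/eqP: numE.
  rewrite z0 mulr0 mul0r mulf_eq0 expf_eq0 /= andbF /=.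
  by rewrite numq_eq0 (negPf q0).
move: numE => /(congr1 (fun x : int => logn p `|x|%N)).
have p0 := prime_gt0 pr_p.
rewrite !abszM !abszX /= !lognM ?muln_gt0 ?expn_gt0 ?p0 ?z0 //.
rewrite !lognX (logn_prime p pr_p) eqxx.
have l4 : logn p 4 = 0%N.
  rewrite -[4%N]/(2 ^ 2)%N lognX (logn_prime p (isT : prime 2)).
  by have -> : (p == 2%N) = false by apply: contraTF odd_p => /eqP->.
rewrite [X in (N * X)%N]l4 muln0 add0n /valp => ->; lia.
Qed.

(** The hypothesis makes the first row of [B] congruent to that of [l A_0] modulo [p], up to the
    unit 4, and this survives the addition of [p C]. By symmetry the first column behaves alike, so
    the determinant of the pencil lies in the square of the ideal [(p, X - l)]. *)
Lemma strongly_divides_shift (g p : nat) (B : 'M[rat]_(g.*2.+2)) (l : int) :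
    (0 < g)%N -> prime p -> odd p -> in_quarterW0Z B ->
    (forall j, exists c : int,
       4%:R * (B ord0 j - l%:~R * antidiag rat _ ord0 j) = (p%:Z * c)%:~R) ->
  strongly_divides p B.
Proof.
move=> g0 pr_p odd_p [[symB zB] intB] rowB C [[symC zC] intC].
have [B' B'E] : exists B', B' = B + p%:R *: C by eexists.
rewrite -B'E; set n := g.*2.+2 in B symB zB intB rowB C symC zC intC B' B'E *.
pose A := antidiag int n.
have symB' : B'^T = B' by rewrite B'E linearD linearZ /= symB symC.
have intB' i j : 4%:R * B' i j \is a Num.int.
  by rewrite B'E !mxE mulrDr rpredD ?intB // mulrCA rpredM ?intC ?rpred_nat.
pose Z : 'M[int]_n := \matrix_(i, j) Num.floor (4%:R * B' i j).
have ZE i j : (Z i j)%:~R = 4%:R * B' i j by rewrite mxE floorK.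
have symZ : Z^T = Z.
  by apply/matrixP=> i j; rewrite !mxE -{1}symB' mxE.
(* Four times the pencil of [B'], which is integral; its determinant is rescaled by [4^n]. *)
pose M : 'M[{poly int}]_n := (4%:Z%:P * 'X) *: map_mx polyC A - map_mx polyC Z.
pose F := (-1) ^+ g.+1 * \det M.
have FE : map_poly intr F = 4%:R ^+ n *: fpoly B'.
  rewrite /fpoly /F rmorphM rmorph_sign /= scalerAr; congr (_ * _).
  rewrite -mul_polyC rmorphXn -detZ -det_map_mx; congr (\det _).
  apply/matrixP=> i j; rewrite !mxE rmorphB !rmorphM /= !map_polyC map_polyX /=.
  have := ZE i j; rewrite mxE => ->.
  by rewrite mulrBr mulrA polyCM !rmorph_nat.
have inj : injective (intr : int -> rat) by apply: intr_inj.
have four0 k : (4%:R : rat) ^+ k != 0 by rewrite expf_neq0.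
have sizeF : size F = n.+1.
  by rewrite -(size_map_inj_poly inj) // FE size_scale ?size_fpoly.
have leadF : F`_n = 4%:Z ^+ n.
  apply: inj; rewrite -coef_map /= FE coefZ rmorphXn /=.
  have := fpoly_monic B'; rewrite monicE /lead_coef size_fpoly => /eqP->.
  by rewrite mulr1.
(* The leading coefficient [4^n] is invertible modulo the odd prime [p]. *)
have redF : reduce p F != 0.
  have : (reduce p F)`_n != 0; last by apply: contraNneq => ->; rewrite coef0.
  rewrite coef_map leadF /= rmorphXn expf_neq0 //= -[4%:Z]/(2%:Z * 2%:Z).
  by rewrite rmorphM /= mulf_neq0 ?two_neq0_Fp.
have ME i j : M i j = 4%:Z%:P * 'X * (A i j)%:P - (Z i j)%:P by rewrite !mxE.
have MS i j : M i j = M j i.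
  rewrite !ME; congr (_ * _%:P - _%:P).
    by rewrite /A -[in LHS](antidiag_tr int n) mxE.
  by rewrite -[in LHS]symZ mxE.
have row0 j : (p%:Z %| (M ord0 j).[l])%Z.
  have [c cE] := rowB j; have /intrP[d dE] := intC ord0 j.
  apply/dvdzP; exists (- (c + d)); apply: inj.
  rewrite ME !hornerE /= rmorphB /= ZE B'E [(B + _) _ _]mxE [(_ *: C) _ _]mxE.
  have -> : A ord0 j = (j == rev_ord ord0)%:R by rewrite mxE.
  move: cE; rewrite [antidiag _ _ _ _]mxE !rmorphM /= rmorphN rmorphD /= -dE !rmorph_nat.
  set x := (_ == _)%:R => cE.
  have BE : 4%:R * B ord0 j = p%:R * c%:~R + 4%:R * l%:~R * x.
    by rewrite -cE; ring.
  by rewrite mulrDr BE; ring.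
have [F1 F2] : (p%:Z ^+ 2 %| (\det M).[l])%Z /\ (p%:Z %| (\det M)^`().[l])%Z.
  apply: det_sqr_ideal => // [|i]; last by rewrite MS.
  (* The corner lies in the zero block because [g >= 1], and off the anti-diagonal of [A_0]. *)
  rewrite !mxE -val_eqE /= mulr0 sub0r.
  have -> : Num.floor (4%:R * B' ord0 ord0) = 0.
    by rewrite B'E !mxE zB // zC // mulr0 addr0 mulr0 Num.Theory.floor0.
  by rewrite oppr0.
have sgnE : (-1) ^+ g.+1 = ((-1) ^+ g.+1)%:P :> {poly int} by rewrite rmorph_sign.
have Fl : (p%:Z ^+ 2 %| F.[l])%Z by rewrite /F sgnE hornerCM dvdz_signl.
have F'l : (p%:Z %| F^`().[l])%Z.
  by rewrite /F sgnE mul_polyC derivZ hornerZ dvdz_signl.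
have := sqr_dvd_resultant_deriv pr_p _ redF Fl F'l.
rewrite sizeF => /(_ isT)/dvdzP[z resF].
have := resultant_intr F F^`(); rewrite -deriv_map /= FE derivZ resultantZ //.
rewrite resF mulrC -exprM /discr; set k := (_ * _)%N; set r := resultant _ _ => rE.
rewrite -signr_odd; set b := odd _.
apply: (@valp_ge_quarter p k _ ((-1) ^+ b * z)) => //.
by rewrite mulrCA [_ * r]mulrC rE [in RHS]mulrCA (mulrC z) [in RHS]rmorphM /= rmorph_sign.
Qed.

(** * The matrix sigma(f) and its characteristic polynomial *)

(** Put [alpha = h_(2g+1) / 2]. The entries with [a + b = 2g], next to the anti-diagonal, give the
    pencil. The block of indices above [g] is tridiagonal, with [c] counted back from the last
    index: for [h_(2g+2) = 1] its quadratic form takes the value [(z^(g+1) + alpha z^g)^2 - f] at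
    [w = (z^g, ..., z, m)]. Completing this square explains the correction by [alpha^2] at
    [c = g]. *)
Definition sigma_entry (g : nat) (m : rat) (h : nat -> rat) (i j : nat) : rat :=
  let a := minn i j in let b := maxn i j in let c := (g.*2.+1 - a)%N in
  if (a <= g)%N then
    if (a + b == g.*2)%N then (if a == 0%N then m else 1)
    else if (a == g) && (b == g.+1) then - (h g.*2.+1 / 2%:R) else 0
  else if a == b then
    - (if c == 0%N then h 0%N / m ^+ 2
       else if c == g then h g.*2 - (h g.*2.+1 / 2%:R) ^+ 2 else h c.*2)
  else if b == a.+1 then - (h c.*2.-1 / 2%:R / (if c == 1%N then m else 1))
  else 0.

Definition sigma_mx (g : nat) (m l : rat) (h : nat -> rat) : 'M[rat]_(g.*2.+2) :=
  \matrix_(i, j) sigma_entry g m h i j + l *: antidiag rat _.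

Lemma sum_support (V : zmodType) (n : nat) (F : nat -> V) (s : seq nat) :
    uniq s -> all (fun j => j < n)%N s ->
    (forall j, (j < n)%N -> j \notin s -> F j = 0) ->
  \sum_(j < n) F j = \sum_(j <- s) F j.
Proof.
move=> us /allP lt_s F0; rewrite -(big_mkord xpredT F).
rewrite (bigID (fun j => j \in s)) /= [X in _ + X]big_nat_cond.
rewrite [X in _ + X]big1 ?addr0 => [|j /andP[/andP[_ jn] js]]; last exact: F0.
rewrite -big_filter; apply/perm_big/uniq_perm => //.
  by rewrite filter_uniq // /index_iota iota_uniq.
move=> j; rewrite mem_filter mem_index_iota leq0n /=.
by case: (boolP (j \in s)) => //= /lt_s.
Qed.

(** Multiplying by the adjugate gives [det M * y_i = f * (adj M)_ij], and [y_i] is a unit. *)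
Lemma dvdp_det_vector (F : fieldType) (n : nat) (M : 'M[{poly F}]_n)
    (y : 'cV[{poly F}]_n) (f : {poly F}) (c : F) (i j : 'I_n) :
    M *m y = f *: delta_mx j 0 -> y i 0 = c%:P -> c != 0 -> f %| \det M.
Proof.
move=> My yi c0.
have : \det M *: y = f *: (\adj M *m delta_mx j 0).
  by rewrite scalemxAr -My mulmxA mul_adj_mx mul_scalar_mx.
move/matrixP/(_ i 0); rewrite !mxE yi mulrC mul_polyC => detE.
by rewrite -(dvdpZr _ _ c0) detE dvdp_mulr.
Qed.

(** * Solving the linear system row by row *)

Section SigmaEntries.

Variables (g : nat) (m : rat) (h : nat -> rat).
Local Notation E := (sigma_entry g m h).
Local Notation alpha := (h g.*2.+1 / 2%:R).

Lemma sigma_entryC i j : E i j = E j i.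
Proof. by rewrite /sigma_entry minnC maxnC. Qed.

Lemma sigma_entry_anti i j : (i <= g)%N -> (i + j = g.*2)%N ->
  E i j = if i == 0%N then m else 1.
Proof.
move=> ig ij; rewrite /sigma_entry.
have -> : minn i j = i by lia.
have -> : maxn i j = j by lia.
by rewrite ig ij eqxx.
Qed.

Lemma sigma_entry_mid : E g g.+1 = - alpha.
Proof.
rewrite /sigma_entry; have -> : minn g g.+1 = g by lia.
have -> : maxn g g.+1 = g.+1 by lia.
rewrite leqnn !eqxx /=; case: eqP => //; lia.
Qed.

Lemma sigma_entry_diag k : (g < k <= g.*2.+1)%N -> E k k =
  - (if k == g.*2.+1 then h 0%N / m ^+ 2
     else if k == g.+1 then h g.*2 - alpha ^+ 2 else h (g.*2.+1 - k).*2).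
Proof.
case/andP=> gk kg; rewrite /sigma_entry minnn maxnn leqNgt gk eqxx /=.
have -> : (g.*2.+1 - k == 0)%N = (k == g.*2.+1) by lia.
by have -> : (g.*2.+1 - k == g)%N = (k == g.+1) by lia.
Qed.

Lemma sigma_entry_off k : (g < k <= g.*2)%N -> E k k.+1 =
  - (h (g.*2.+1 - k).*2.-1 / 2%:R / (if k == g.*2 then m else 1)).
Proof.
case/andP=> gk kg; rewrite /sigma_entry.
have -> : minn k k.+1 = k by lia.
have -> : maxn k k.+1 = k.+1 by lia.
rewrite leqNgt gk eqxx (ltn_eqF (ltnSn k)) /=.
by have -> : (g.*2.+1 - k == 1)%N = (k == g.*2) by lia.
Qed.

Lemma sigma_entry0 i j : (i + j != g.*2)%N ->
  ((i == g) ==> (j != g.+1)) -> ((j == g) ==> (i != g.+1)) ->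
  ((i <= g) || (j <= g) || [&& i != j, i != j.+1 & j != i.+1])%N -> E i j = 0.
Proof.
move=> ij1 ij2 ij3 ij4; rewrite /sigma_entry.
have -> : (minn i j + maxn i j == g.*2)%N = false by lia.
have -> : (minn i j == g) && (maxn i j == g.+1) = false by lia.
case: leqP => // ?.
have -> : (minn i j == maxn i j) = false by lia.
by have -> : (maxn i j == (minn i j).+1) = false by lia.
Qed.

Hypotheses (g0 : (0 < g)%N) (m0 : m != 0).
Variable z : {poly rat}.

(** The terms of degree at least [2c] of [f = sum_k h_k z^k], divided by [z^c]; for [c = 0] this is
    [f] itself. *)
Definition sigma_tail (c : nat) : {poly rat} :=
  \sum_(j < g.*2.+3 - c.*2) h (c.*2 + j) *: z ^+ (c + j).

Lemma sigma_tailS c : (c <= g)%N -> sigma_tail c =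
  h c.*2 *: z ^+ c + h c.*2.+1 *: z ^+ c.+1 + z * sigma_tail c.+1.
Proof.
move=> cg; rewrite /sigma_tail.
have -> : (g.*2.+3 - c.*2 = (g.*2.+3 - c.+1.*2).+2)%N by lia.
rewrite !big_ord_recl /= !addn0 addrA /bump !addn1; congr (_ + _).
rewrite mulr_sumr; apply: eq_bigr => j _; rewrite -scalerAr -exprS /=.
by congr (h _ *: z ^+ _); rewrite /bump /=; lia.
Qed.

Lemma sigma_tail_last : h g.*2.+2 = 1 -> sigma_tail g.+1 = z ^+ g.+1.
Proof.
move=> h1; rewrite /sigma_tail (_ : _ - _ = 1)%N; last by lia.
by rewrite big_ord1 !addn0 doubleS h1 scale1r.
Qed.

(* The solution of [(A_0 X - B) y = (f / m) e_n] found by elimination: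
   indices above [g] span the kernel of the top-right pencil. *)
Definition sigma_vec (k : nat) : {poly rat} :=
  if (k < g)%N then
    (if k == 0%N then m else 1)^-1 *:
      (sigma_tail k.+1 + (h k.*2.+1 / 2%:R) *: z ^+ k)
  else if k == g then z ^+ g.+1 + alpha *: z ^+ g
  else if k == g.*2.+1 then m%:P else z ^+ (g.*2.+1 - k).

Lemma sigma_vec_low k : (k < g)%N -> sigma_vec k = (if k == 0%N then m else 1)^-1 *:
      (sigma_tail k.+1 + (h k.*2.+1 / 2%:R) *: z ^+ k).
Proof. by rewrite /sigma_vec => ->. Qed.

Lemma sigma_vec_mid : sigma_vec g = z ^+ g.+1 + alpha *: z ^+ g.
Proof. by rewrite /sigma_vec ltnn eqxx. Qed.

Lemma sigma_vec_last : sigma_vec g.*2.+1 = m%:P.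
Proof.
rewrite /sigma_vec eqxx.
have -> : (g.*2.+1 < g)%N = false by lia.
by have -> : (g.*2.+1 == g)%N = false by lia.
Qed.

Lemma sigma_vec_high k : (g < k <= g.*2)%N -> sigma_vec k = z ^+ (g.*2.+1 - k).
Proof.
move=> gk; rewrite /sigma_vec.
have -> : (k < g)%N = false by lia.
have -> : (k == g)%N = false by lia.
by have -> : (k == g.*2.+1)%N = false by lia.
Qed.

Local Notation row k := (\sum_(j < g.*2.+2) (E k j)%:P * sigma_vec j).

(** Since [A_0 X - B = z A_0 - E] and [A_0] reverses indices, row [k] of the system reads
    [(E y)_k = z y_(2g+1-k)], except for the last one. The rows below [g] say that [w] is in the
    kernel of the pencil; row [g] determines [y_g], and row [k > g] determines [y_(2g-k)]. *)
Lemma sigma_row_low k : (k < g)%N -> row k = z * sigma_vec (g.*2.+1 - k).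
Proof.
move=> kg.
rewrite (@sum_support _ _ (fun j => (E k j)%:P * sigma_vec j) [:: (g.*2 - k)%N]) //=;
  last 2 first.
- by rewrite andbT; lia.
- by move=> j jn; rewrite inE => jk; rewrite sigma_entry0 ?mul0r //; lia.
rewrite big_seq1 sigma_entry_anti; [|lia|lia]; rewrite sigma_vec_high; last by lia.
case: eqP => [->|k0].
  by rewrite !subn0 sigma_vec_last subSnn expr1 mulrC.
rewrite sigma_vec_high; last by lia.
by rewrite mul1r -exprS; congr (z ^+ _); lia.
Qed.

Lemma sigma_row_mid : row g = z * sigma_vec g.+1.
Proof.
rewrite (@sum_support _ _ (fun j => (E g j)%:P * sigma_vec j) [:: g; g.+1]) //=;
  last 3 first.
- by rewrite inE andbT; lia.
- by rewrite andbT; lia.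
- by move=> j jn; rewrite !inE => jk; rewrite sigma_entry0 ?mul0r //; lia.
rewrite big_cons big_seq1 sigma_entry_mid sigma_entry_anti; [|lia|lia].
have -> : (g == 0)%N = false by lia.
rewrite sigma_vec_mid sigma_vec_high; last by lia.
have -> : (g.*2.+1 - g.+1 = g)%N by lia.
by rewrite mul1r polyCN mulNr mul_polyC addrK exprS.
Qed.

(** The [1 / m] in the entry next to the corner cancels the last coordinate [m] of the vector, which
    makes both cases uniform. *)
Lemma sigma_off_vec k : (g < k <= g.*2)%N -> (E k k.+1)%:P * sigma_vec k.+1 =
  - ((h (g.*2.+1 - k).*2.-1 / 2%:R) *: z ^+ (g.*2 - k)).
Proof.
move=> gk; rewrite sigma_entry_off //; case: eqP => [->|kg].
  by rewrite sigma_vec_last subnn expr0 -polyCM mulNr divfK // alg_polyC polyCN.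
rewrite sigma_vec_high; last by lia.
by rewrite subSS divr1 mul_polyC scaleNr.
Qed.

(** The [alpha^2] in the diagonal entry cancels the product of the entry [- alpha] with the term
    [alpha z^g] of [y_g]. *)
Lemma sigma_row_first : h g.*2.+2 = 1 -> row g.+1 = z * sigma_vec g.
Proof.
move=> h1.
rewrite (@sum_support _ _ (fun j => (E g.+1 j)%:P * sigma_vec j)
  [:: g.-1; g; g.+1; g.+2]) //=; last 3 first.
- by rewrite !inE; lia.
- by rewrite andbT; lia.
- by move=> j jn; rewrite !inE => jk; rewrite sigma_entry0 ?mul0r //; lia.
rewrite !big_cons big_nil addr0 (sigma_entryC g.+1 g) sigma_entry_mid.
rewrite (sigma_entryC g.+1 g.-1) sigma_entry_anti; [|lia|lia].
rewrite sigma_entry_diag; last by lia.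
have -> : (g.+1 == g.*2.+1) = false by lia.
rewrite eqxx sigma_vec_low; last by lia.
rewrite mul_polyC scalerA divff ?scale1r; last by case: ifP; rewrite ?oner_neq0.
rewrite sigma_vec_mid sigma_vec_high; last by lia.
have -> : (g.*2.+1 - g.+1 = g)%N by lia.
rewrite prednK //.
rewrite sigma_off_vec; last by lia.
have -> : (g.*2 - g.+1 = g.-1)%N by lia.
have -> : (g.*2.+1 - g.+1 = g)%N by lia.
have -> : g.-1.*2.+1 = g.*2.-1 by lia.
rewrite sigma_tailS // sigma_tail_last // -!mul_polyC !(exprS z).
set a := alpha; have -> : h g.*2.+1 = a + a by rewrite /a; field.
move: a (h g.*2.-1 / _) => a b.
by rewrite !(polyCN, polyCB, polyCD) polyCM; ring.
Qed.

Lemma sigma_row_high k : (g.+1 < k <= g.*2)%N ->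
  row k = z * sigma_vec (g.*2.+1 - k).
Proof.
move=> gk.
rewrite (@sum_support _ _ (fun j => (E k j)%:P * sigma_vec j)
  [:: g.*2 - k; k.-1; k; k.+1]%N) //=; last 3 first.
- by rewrite !inE; lia.
- by rewrite andbT; lia.
- by move=> j jn; rewrite !inE => jk; rewrite sigma_entry0 ?mul0r //; lia.
rewrite !big_cons big_nil addr0.
rewrite (sigma_entryC k (_ - k)) sigma_entry_anti; [|lia|lia].
rewrite sigma_vec_low; last by lia.
rewrite mul_polyC scalerA divff ?scale1r; last by case: ifP; rewrite ?oner_neq0.
have -> : E k k.-1 = E k.-1 k.-1.+1 by rewrite sigma_entryC prednK; [|lia].
rewrite sigma_entry_off ?sigma_entry_diag ?sigma_off_vec; [|lia|lia|lia].
rewrite (@sigma_vec_high k) ?(@sigma_vec_high k.-1); [|lia|lia].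
have -> : (k == g.*2.+1) = false by lia.
have -> : (k == g.+1) = false by lia.
have -> : (k.-1 == g.*2) = false by lia.
have [i iE] : exists i, i = (g.*2.+1 - k)%N by eexists.
rewrite (_ : g.*2.+1 - k.-1 = i.+1)%N; last by lia.
rewrite (_ : g.*2.+1 - k = i)%N; last by lia.
rewrite (_ : g.*2 - k = i.-1)%N; last by lia.
rewrite sigma_vec_low; last by lia.
rewrite prednK; last by lia.
rewrite (_ : i.-1.*2.+1 = i.*2.-1)%N; last by lia.
rewrite (_ : i.+1.*2.-1 = i.*2.+1)%N; last by lia.
have -> : (i == 0%N) = false by lia.
rewrite sigma_tailS; last by lia.
rewrite invr1 divr1 scale1r -!mul_polyC exprS.
rewrite (_ : h i.*2.+1 = h i.*2.+1 / 2%:R + h i.*2.+1 / 2%:R); last by field.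
move: (h i.*2.-1 / _) (h i.*2.+1 / _) => a b.
by rewrite (_ : (b + b) / 2%:R = b); [rewrite !(polyCN, polyCD); ring | field].
Qed.

(** No low index is left to absorb the remainder, so the elimination ends with the defect
    [f / m]. *)
Lemma sigma_row_last :
  row g.*2.+1 = z * sigma_vec 0%N - m^-1 *: sigma_tail 0%N.
Proof.
rewrite (@sum_support _ _ (fun j => (E g.*2.+1 j)%:P * sigma_vec j)
  [:: g.*2; g.*2.+1]%N) //=; last 3 first.
- by rewrite !inE; lia.
- by rewrite andbT; lia.
- by move=> j jn; rewrite !inE => jk; rewrite sigma_entry0 ?mul0r //; lia.
rewrite big_cons big_seq1 sigma_entryC sigma_entry_off; last by lia.
rewrite sigma_entry_diag; last by lia.
rewrite !eqxx sigma_vec_last (sigma_vec_low g0) (@sigma_vec_high g.*2); last by lia.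
rewrite subSnn (sigma_tailS (leq0n g)) /= !expr0 expr1.
rewrite -!mul_polyC mulr1.
rewrite -[0.*2.+1]/1%N -[0.*2]/0%N.
have -> : (- (h 0%N / m ^+ 2))%:P * m%:P = - ((m^-1)%:P * (h 0%N)%:P).
  by rewrite -!polyCM -polyCN; congr (_%:P); field.
rewrite (_ : h 1%N = h 1%N / 2%:R + h 1%N / 2%:R); last by field.
move: (h 1%N / _) => a; rewrite (_ : (a + a) / 2%:R = a); last by field.
by move: (m^-1) => b; rewrite !(polyCN, polyCD) (polyCM a); ring.
Qed.

End SigmaEntries.
Lemma fpoly_sigma_mx (g : nat) (m l : rat) (h : nat -> rat) (f : {poly rat}) :
    (0 < g)%N -> m != 0 -> h g.*2.+2 = 1 -> f \is monic -> size f = g.*2.+3 ->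
    f = sigma_tail g h ('X - l%:P) 0 ->
  fpoly (sigma_mx g m l h) = f.
Proof.
move=> g0 m0 h1 mon_f size_f fE; set z := 'X - l%:P in fE.
pose M := 'X *: map_mx polyC (antidiag rat g.*2.+2) - map_mx polyC (sigma_mx g m l h).
pose y : 'cV[{poly rat}]_(g.*2.+2) := \col_j sigma_vec g m h z j.
have My : M *m y = (m^-1 *: f) *: delta_mx ord_max 0.
  apply/matrixP=> i j; rewrite ord1 {j}.
  have -> : (M *m y) i 0 = z * sigma_vec g m h z (g.*2.+1 - i) -
      \sum_(j < g.*2.+2) (sigma_entry g m h i j)%:P * sigma_vec g m h z j.
    transitivity (\sum_j (z * (j == rev_ord i)%:R * sigma_vec g m h z j -
        (sigma_entry g m h i j)%:P * sigma_vec g m h z j)).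
      rewrite mxE; apply: eq_bigr => j _; rewrite !mxE -mulrBl; congr (_ * _).
      by rewrite polyCD polyCM rmorph_nat /z; ring.
    rewrite sumrB; congr (_ - _); rewrite (bigD1 (rev_ord i)) //= eqxx mulr1.
    rewrite big1 ?addr0 => [|j /negPf->]; last by rewrite mulr0 mul0r.
    by rewrite subSS.
  rewrite !mxE -val_eqE /= andbT; have := ltn_ord i; move: (nat_of_ord i) => {i} k kn.
  have [->|kl] := eqVneq k g.*2.+1.
    by rewrite sigma_row_last // subnn opprB addrC subrK mulr1 fE.
  rewrite mulr0; apply/eqP; rewrite subr_eq0 eq_sym; apply/eqP.
  case: (ltngtP k g) => [kg|kg|->]; first exact: sigma_row_low.
    case: (ltngtP k g.+1) => [|kg1|->]; [by lia| |].
      by apply: sigma_row_high => //; lia.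
    rewrite sigma_row_first //; congr (z * sigma_vec _ _ _ _ _); lia.
  rewrite sigma_row_mid //; congr (z * sigma_vec _ _ _ _ _); lia.
have : m^-1 *: f %| \det M.
  apply: (dvdp_det_vector (i := ord_max) My _ m0).
  by rewrite mxE sigma_vec_last.
rewrite dvdpZl ?invr_eq0 // => fM.
apply/eqP; rewrite eq_sym -eqp_monic ?fpoly_monic //.
rewrite -dvdp_size_eqp ?size_f ?size_fpoly //.
by rewrite /fpoly dvdp_mull.
Qed.

Lemma sigma_mx_quarterW0Z (g m : nat) (l : int) (h : nat -> rat) :
    (0 < g)%N -> (0 < m)%N -> (forall k, h k \is a Num.int) ->
    4%:R * (h 0%N / m%:R ^+ 2) \is a Num.int ->
    2%:R * (h 1%N / m%:R) \is a Num.int ->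
  in_quarterW0Z (sigma_mx g m%:R l%:~R h).
Proof.
move=> g0 m0 hZ h0 h1; split; last first.
  move=> i j; rewrite !mxE mulrDr rpredD //; last first.
    by rewrite !rpredM ?rpred_nat ?rpred_int.
  have half x : x \is a Num.int -> 4%:R * (x / 2%:R) \is a @Num.int rat.
    move=> xZ; have -> : 4%:R * (x / 2%:R) = 2%:R * x by field.
    by rewrite rpredM ?rpred_nat.
  have quart x : x \is a Num.int -> 4%:R * (x / 2%:R) ^+ 2 \is a @Num.int rat.
    move=> xZ; have -> : 4%:R * (x / 2%:R) ^+ 2 = x ^+ 2 by field.
    by rewrite rpredX.
  rewrite /sigma_entry; set c := (_ - minn _ _)%N.
  case: ifP => _.
    case: ifP => _; first by case: ifP; rewrite !rpredM ?rpred_nat ?rpred1.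
    by case: ifP; rewrite ?mulr0 ?rpred0 // mulrN rpredN half.
  case: ifP => _.
    rewrite mulrN rpredN; case: eqP => // _.
    by case: eqP => _; rewrite ?mulrBr ?rpredB ?quart ?rpredM ?rpred_nat.
  case: ifP => _; last by rewrite mulr0 rpred0.
  rewrite mulrN rpredN; case: (c =P 1%N) => [->|_]; last by rewrite divr1 half.
  suff -> : 4%:R * (h 1.*2.-1 / 2%:R / m%:R) = 2%:R * (h 1%N / m%:R) by [].
  by rewrite -[1.*2.-1]/1%N; field; rewrite pnatr_eq0 -lt0n.
split=> [|i j ig jg].
  rewrite /sigma_mx linearD linearZ /= antidiag_tr; congr (_ + _).
  by apply/matrixP=> i j; rewrite !mxE sigma_entryC.
(* Here [i + j < 2g], so the position precedes both anti-diagonals that may carry entries. *)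
rewrite !mxE sigma_entry0; [|lia|lia|lia|lia].
have -> : (j == rev_ord i) = false by rewrite -val_eqE /=; lia.
by rewrite mulr0 addr0.
Qed.

(** * The invariant Q *)

(* Along a permutation whose terms are all nonzero the rank never decreases,
   so it is constant and only [s0] contributes. *)
Lemma det_ranked (R : comNzRingType) (n : nat) (s0 : 'S_n) (rho : 'I_n -> nat)
    (M : 'M[R]_n) :
    (forall i j, M i (s0 j) != 0 -> i = j \/ (rho i < rho j)%N) ->
  \det M = (-1) ^+ s0 * \prod_i M i (s0 i).
Proof.
move=> ranked; rewrite /determinant (bigD1 s0) //= [X in _ + X]big1 ?addr0 // => s ss0.
suff /existsP[i /eqP Mi] : [exists i, M i (s i) == 0].
  by rewrite (bigD1 i) //= Mi mul0r mulr0.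
apply: contraNT ss0 => /existsPn Mn0.
pose t : 'S_n := (s * s0^-1)%g.
have st i : s i = s0 (t i) by rewrite permM permKV.
have le_t i : (rho i <= rho (t i))%N.
  have := Mn0 i; rewrite st => /ranked[eq_i|/ltnW //].
  by rewrite -eq_i.
have sum_t : (\sum_i rho (t i) = \sum_i rho i)%N.
  by rewrite [RHS](reindex_inj (@perm_inj _ t)).
apply/eqP/permP=> i; rewrite st; congr (s0 _); apply/eqP; apply: contraT => ti.
have : (rho i < rho (t i))%N.
  by have := Mn0 i; rewrite st => /ranked[eq_i|//]; rewrite -eq_i eqxx in ti.
move=> lt_i; have : (\sum_i rho i < \sum_i rho (t i))%N.
  by rewrite (bigD1 i) //= [ltnRHS](bigD1 i) //= -addSn leq_add // leq_sum.
by rewrite sum_t ltnn.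
Qed.

Section SigmaQ.

Variables (g : nat) (m l : rat) (h : nat -> rat).
Hypotheses (g0 : (0 < g)%N) (m0 : m != 0).

Local Notation Y := ('X%:P : {poly {poly rat}}).
(** The binary form [x - l y], the homogeneous version of [z]. *)
Let Z : {poly {poly rat}} := 'X - (l *: 'X)%:P.
Let weight (i : nat) : rat := if i == 0%N then m else 1.

Lemma top_right_antidiag (i : 'I_g) (j : 'I_g.+1) :
  top_right (antidiag rat g.*2.+2) i j = (i + j == g)%N%:R.
Proof.
rewrite !mxE -val_eqE /= !inordK; [|have := ltn_ord i; lia|have := ltn_ord j; lia].
by congr (_%:R); congr nat_of_bool; have := ltn_ord i; have := ltn_ord j; lia.
Qed.

Lemma top_right_sigma_mx (i : 'I_g) (j : 'I_g.+1) :
  top_right (sigma_mx g m l h) i j =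
    weight i * (i + j.+1 == g)%N%:R + l * (i + j == g)%N%:R.
Proof.
have lt_i := ltn_ord i; have lt_j := ltn_ord j.
rewrite -top_right_antidiag !mxE !inordK; [|lia|lia]; congr (_ + _).
case: eqP => ij; last by rewrite mulr0 sigma_entry0 //; lia.
by rewrite sigma_entry_anti ?mulr1 //; lia.
Qed.

Lemma prod_threshold (R : comNzRingType) (c : nat) (x : nat -> R) (y : R) :
    (c <= g)%N ->
  \prod_(i < g) (if (g - i.+1 < c)%N then x (g - i.+1)%N else y) =
    (\prod_(k < c) x k) * y ^+ (g - c).
Proof.
move=> cg; rewrite (reindex_inj rev_ord_inj) /=.
have revK (i : 'I_g) : (g - (g - i.+1).+1 = i)%N by have := ltn_ord i; lia.
under eq_bigr => i _ do rewrite revK.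
rewrite -(big_mkord xpredT (fun k => if (k < c)%N then x k else y)).
rewrite (big_cat_nat (leq0n c) cg) /= -prodr_const_nat -(big_mkord xpredT x).
congr (_ * _); apply: eq_big_nat => k /andP[k1 k2]; first by rewrite k2.
by rewrite ltnNge k1.
Qed.

(** Row [i] has only two entries: a multiple of [Y] in column [g - 1 - i] and [Z] in column [g - i].
    Once column [c] is deleted, a single transversal survives: it takes the [Y] entries in the
    columns before [c] and the [Z] entries after it. The weight [m] sits in column [g - 1], so it
    occurs only for [c = g]. *)
Lemma pencil_minor_sigma_mx (c : 'I_g.+1) : exists e : nat,
  pencil_minor (top_right (antidiag rat _)) (top_right (sigma_mx g m l h)) c =
    (((-1) ^+ e * if c == g :> nat then m else 1) *: 'X^c)%:P * Z ^+ (g - c).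
Proof.
move: top_right_antidiag top_right_sigma_mx; rewrite /pencil_minor.
move: (top_right _) (top_right _) => TA TB TAE TBE; set N := col' c _.
have NE i j : N i j = Z * (i + lift c j == g)%N%:R
    - Y * (weight i)%:P%:P * (i + (lift c j).+1 == g)%N%:R.
  rewrite !mxE TAE TBE /Z.
  by rewrite !(rmorphD, rmorphM, rmorph_nat) /= -mul_polyC !polyCM; ring.
pose s0 : 'S_g := perm rev_ord_inj.
(* The second entry of a row, if not deleted, lies in the column matched with the preceding row for
   [Y] rows and with the following row for [Z] rows; hence a rank decreasing in [i] on the former
   and increasing on the latter. *)
pose rho (i : 'I_g) := if (g - i.+1 < c)%N then (g - i)%N else nat_of_ord i.
have lt_c := ltn_ord c.
have ranked i j : N i (s0 j) != 0 -> i = j \/ (rho i < rho j)%N.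
  move=> Nij; have [->|ij] := eqVneq i j; [by left | right].
  have lt_i := ltn_ord i; have lt_j := ltn_ord j.
  move: Nij; have {}ij : (i : nat) != j by [].
  rewrite NE permE /rho /= /bump.
  case: (eqVneq (_ + (_ + _))%N g) => [e1|n1].
    by move: e1; case: (leqP c (g - j.+1)) => ? /= ? _; case: ifP => ?; lia.
  case: (eqVneq _ g) => [e2|n2]; last by rewrite !mulr0 subrr eqxx.
  by move: e2; case: (leqP c (g - j.+1)) => ? /= ? _; case: ifP => ?; lia.
rewrite (det_ranked ranked).
have NsE i : N i (s0 i) =
    if (g - i.+1 < c)%N then - Y * (weight (g - (g - i.+1).+1))%:P%:P else Z.
  have lt_i := ltn_ord i; rewrite NE permE /= /bump.
  have -> : (g - (g - i.+1).+1 = i)%N by lia.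
  case: leqP => ck.
    have -> : (i + (1 + (g - i.+1)) == g)%N by lia.
    have -> : (i + (1 + (g - i.+1)).+1 == g)%N = false by lia.
    by rewrite mulr1 mulr0 subr0.
  have -> : (i + (0 + (g - i.+1)) == g)%N = false by lia.
  have -> : (i + (0 + (g - i.+1)).+1 == g)%N by lia.
  by rewrite mulr1 mulr0 sub0r mulNr.
under eq_bigr => i _ do rewrite NsE.
rewrite (prod_threshold (fun k => - Y * (weight (g - k.+1))%:P%:P)) //.
rewrite big_split /= prodr_const card_ord.
have -> : \prod_(k < c) (weight (g - k.+1))%:P%:P =
    (if c == g :> nat then m else 1)%:P%:P :> {poly {poly rat}}.
  case: eqP => cg.
    rewrite cg -(prednK g0) big_ord_recr /= subnn big1 ?mul1r // => k _.
    by rewrite /weight (_ : (_ == _) = false) //; have := ltn_ord k; lia.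
  rewrite big1 // => k _; rewrite /weight (_ : (_ == _) = false) //.
  by have := ltn_ord k; lia.
(* The signs come from [pencil_minor], from the permutation and from [(- Y) ^+ c]. *)
exists (c + s0 + c)%N; rewrite -mul_polyC !(polyCM, rmorphXn, rmorphN, rmorph1) /=.
rewrite !exprD [(- Y) ^+ c]exprNn -!mulrA; congr (_ * (_ * (_ * _))).
exact: mulrCA.
Qed.

(** The [i]-th form is, up to its scalar, [y^i (x - l y)^(g-i)], of degree [g - i] in [x] with
    leading coefficient 1. With columns reversed the matrix is therefore triangular, and [m] appears
    once on its diagonal. *)
Lemma Qinv_sigma_mx : `|Qinv (sigma_mx g m l h)| = `|m|.
Proof.
rewrite /Qinv /Qpair; set M := \matrix_(i, j) _.
have monZ : Z \is monic by rewrite /Z monicXsubC.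
have sizeZ k : size (Z ^+ k) = k.+1 by rewrite size_exp_XsubC.
have ranked i j : M i (perm rev_ord_inj j) != 0 ->
    i = j \/ (nat_of_ord i < nat_of_ord j)%N.
  rewrite mxE permE; have [e ->] := pencil_minor_sigma_mx i.
  rewrite coefCM /= => Mij; suff : (i <= j)%N.
    by rewrite leq_eqVlt => /orP[/eqP/val_inj|]; [left | right].
  apply: contraNT Mij => ji; rewrite [(Z ^+ _)`_ _]nth_default ?mulr0 ?coef0 //.
  by rewrite sizeZ; have := ltn_ord i; have := ltn_ord j; lia.
rewrite (det_ranked ranked) normrM normrX normrN1 expr1n mul1r normr_prod.
have ME (i : 'I_g.+1) :
    `|M i (perm rev_ord_inj i)| = if i == g :> nat then `|m| else 1.
  rewrite mxE permE; have [e ->] := pencil_minor_sigma_mx i.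
  rewrite coefCM /= subSS.
  have -> : (Z ^+ (g - i))`_(g - i) = 1.
    have := monic_exp (g - i) monZ.
    by rewrite monicE /lead_coef sizeZ => /eqP.
  rewrite mulr1 coefZ coefXn.
  have -> : (g - (g - i) == i)%N by have := ltn_ord i; lia.
  by rewrite mulr1 normrM normrX normrN1 expr1n mul1r; case: ifP => _; rewrite ?normr1.
under eq_bigr => i _ do rewrite ME.
rewrite big_ord_recr /= eqxx big1 ?mul1r // => i _.
by rewrite (ltn_eqF (ltn_ord i)).
Qed.

End SigmaQ.

(** * Choice of the shift, Taylor coefficients and conclusion *)

(** A good shift only matters modulo [m^2], so a finite search turns its existence into a function
    of [f]; the default 0 is reached only when there is none. *)
Definition shift_of (m : nat) (f : {poly int}) : int :=
  if [pick l : 'I_(m ^ 2) | good_shift f m%:Z (l : nat)%:Z] is Some l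
  then (l : nat)%:Z else 0.

Lemma shift_ofP (m : nat) (f : {poly int}) (l : int) : (0 < m)%N ->
  good_shift f m%:Z l -> good_shift f m%:Z (shift_of m f).
Proof.
move=> m0 good_l; rewrite /shift_of; case: pickP => // none.
have M0 : (m ^ 2)%N%:Z != 0 by rewrite eqz_nat -lt0n expn_gt0 m0.
have lt_l : (`|(l %% (m ^ 2)%N)%Z| < m ^ 2)%N.
  by rewrite -ltz_nat gez0_abs ?modz_ge0 // ltz_pmod // ltz_nat expn_gt0 m0.
have := none (Ordinal lt_l); rewrite /= gez0_abs ?modz_ge0 // => /negP[].
apply: good_shift_mod good_l.
by rewrite -[m%:Z ^+ 2]/((m ^ 2)%N%:Z) -eqz_mod_dvd modz_mod.
Qed.

Definition taylor (l : int) (f : {poly int}) (k : nat) : rat :=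
  ((f \Po ('X + l%:P))`_k)%:~R.

Lemma taylor0 (l : int) (f : {poly int}) : taylor l f 0 = f.[l]%:~R.
Proof. by rewrite /taylor -horner_coef0 horner_comp !hornerE. Qed.

Lemma taylor1 (l : int) (f : {poly int}) : taylor l f 1 = f^`().[l]%:~R.
Proof.
have -> : f^`().[l] = ((f \Po ('X + l%:P))^`()).[0].
  rewrite deriv_comp derivD derivX derivC addr0 mulr1 horner_comp.
  by rewrite !hornerE.
by rewrite horner_coef0 coef_deriv mulr1n.
Qed.

Lemma size_taylor (l : int) (f : {poly int}) :
  size (f \Po ('X + l%:P)) = size f.
Proof. by rewrite -[l%:P]opprK -polyCN size_comp_poly2 // size_XsubC. Qed.

Lemma taylor_lead (l : int) (f : {poly int}) :
  f \is monic -> taylor l f (size f).-1 = 1.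
Proof.
move=> /monicP mon_f; rewrite /taylor -(size_taylor l) -/(lead_coef _).
rewrite -[l%:P]opprK -polyCN lead_coef_comp ?size_XsubC //.
by rewrite lead_coefXsubC expr1n mulr1 mon_f.
Qed.

Lemma taylor_expansion (l : int) (f : {poly int}) :
  map_poly intr f = \sum_(k < size f) taylor l f k *: ('X - l%:~R%:P) ^+ k.
Proof.
have {1}-> : f = (f \Po ('X + l%:P)) \Po ('X - l%:P).
  by rewrite -comp_polyA comp_polyD comp_polyX comp_polyC subrK comp_polyXr.
rewrite map_comp_poly map_polyXsubC /= comp_polyE.
rewrite size_map_inj_poly ?size_taylor //; last exact: intr_inj.
by apply: eq_bigr => k _; rewrite coef_map.
Qed.

Theorem theorem4p2 (g m : nat) (hg : (1 <= g)%N) (hm : (0 < m)%N)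
    (hsf : squarefree m) :
  exists sigma : {poly int} -> 'M[rat]_(g.*2.+2),
    forall f : {poly int}, in_Wm2 g.*2.+2 m f ->
      [/\ in_quarterW0Z (sigma f),
          fpoly (sigma f) = map_poly (fun a : int => a%:~R) f,
          forall p : nat, prime p -> odd p -> (p %| m)%N ->
            strongly_divides p (sigma f)
        & `|Qinv (sigma f)| = m%:R].
Proof.
exists (fun f => let l := shift_of m f in
  sigma_mx g m%:R l%:~R (taylor l f)) => f [mon_f size_f wd] /=.
have [|l0 good_l0] := exists_good_shift hm hsf mon_f _ wd; first by rewrite size_f.
have /andP[f1 f0] := shift_ofP hm good_l0; move: (shift_of m f) f1 f0 => {l0 good_l0} l.
case/dvdzP=> b f1 /dvdzP[c f0].
have m0 : m%:R != 0 :> rat by rewrite pnatr_eq0 -lt0n.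
have W0 : in_quarterW0Z (sigma_mx g m%:R l%:~R (taylor l f)).
  apply: sigma_mx_quarterW0Z => // [k||]; first exact: rpred_int.
    rewrite taylor0 mulrA -[4%:R]/(4%:Z%:~R) -rmorphM /= f0 rmorphM rmorphXn /=.
    by rewrite -pmulrn mulfK ?expf_neq0 ?rpred_int.
  rewrite taylor1 mulrA -[2%:R]/(2%:Z%:~R) -rmorphM /= f1 rmorphM /=.
  by rewrite -pmulrn mulfK ?rpred_int.
split=> // [|p pr_p odd_p /dvdnP[d mE]|].
- rewrite -[map_poly _ f]/(map_poly intr f); apply: fpoly_sigma_mx => //.
  + by have := taylor_lead l mon_f; rewrite size_f.
  + exact: monic_map.
  + by rewrite size_map_inj_poly ?size_f //; apply: intr_inj.
  rewrite (taylor_expansion l) size_f /sigma_tail double0 subn0.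
  by apply: eq_bigr => k _; rewrite !add0n.
- apply: (@strongly_divides_shift _ _ _ l) => // j.
  (* Off [l A_0], the first row of the matrix has the single entry [m = d p], in column [2g]. *)
  exists (4%:Z * (d%:Z * (j == g.*2 :> nat)%:Z)).
  rewrite !mxE addrK /=; case: (eqVneq (nat_of_ord j) g.*2) => [->|jg].
    rewrite sigma_entry_anti ?eqxx // mE natrM.
    by rewrite !rmorphM /= -!pmulrn; ring.
  by rewrite sigma_entry0 ?mulr0 ?(ltn_eqF hg) ?implybT.
by rewrite (Qinv_sigma_mx _ _ hg m0) normr_nat.
Qed.
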